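(* Let $\varepsilon\ge 0$, and consider the problem of minimizing $f(\bm z)$ subject to $\bm z\in\mathcal Z_N^k$, with optimal value $f^\star$, where $f$ is the function defined in the context. The cutting-plane algorithm described in the context, run with tolerance $\varepsilon$, terminates in a finite number of iterations and outputs an $\varepsilon$-optimal solution to this problem, i.e., a vector $\hat{\bm z}\in\mathcal Z_N^k$ with $f^\star\le f(\hat{\bm z})\le f^\star+\varepsilon$.
   Context: Notation: $[N]=\{1,\dots,N\}$; $\bm X\succeq\bm Y$ ($\bm X\succ\bm Y$) means $\bm X-\bm Y$ is (symmetric and) positive semidefinite (positive definite); $\bm A\bullet\bm B=\sum_{n,m}A_{nm}B_{nm}$; $\circ$ is the entrywise product; $\bm 1$ is the all-ones vector; $\bm O$ is the zero matrix; $\mathcal S^N$ is the set of real symmetric $N\times N$ matrices; vector inequalities are entrywise. Data: integers $N,L\ge1$ and $k\in[N]$; $\mathcal Z_N^k=\{\bm z\in\{0,1\}^N:\sum_{n\in[N]}z_n=k\}$; $\mathcal X=\{\bm x\in\mathbb R^N:\sum_{n\in[N]}x_n=1,\ \bm x\ge\bm 0\}$; $a^{(\ell)},b^{(\ell)}\in\mathbb R$ for $\ell\in[L]$; $\gamma>0$; $\kappa_1\ge0$, $\kappa_2\ge1$; for observed $\bm\xi_1,\dots,\bm\xi_M\in\mathbb R^N$, $\hat{\bm\mu}=\frac1M\sum_{m\in[M]}\bm\xi_m$ and $\hat{\bm\Sigma}=\frac1M\sum_{m\in[M]}(\bm\xi_m-\hat{\bm\mu})(\bm\xi_m-\hat{\bm\mu})^\top$.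 Standing assumption: $\kappa_1>0$ and $\hat{\bm\Sigma}\succ\bm O$. The function $f$. For $\bm z\in\mathcal Z_N^k$ and $\bm Z=\mathrm{Diag}(\bm z)$, $f(\bm z)$ is the optimal value of $$ \begin{aligned} \min_{\bm x,\bm P,\bm Q,\bm p,\bm q,r,s}\quad & \tfrac{1}{2\gamma}\bm x^\top\bm x+(\kappa_2\hat{\bm\Sigma}-\hat{\bm\mu}\hat{\bm\mu}^\top)\bullet\bm Q+r+\hat{\bm\Sigma}\bullet\bm P-2\hat{\bm\mu}^\top\bm p+\kappa_1 s\\ \text{s.t.}\quad & \bm p=-\bm q/2-\bm Q\hat{\bm\mu},\quad \begin{pmatrix}\bm Q & \bm q/2+a^{(\ell)}\bm Z\bm x/2\\ (\bm q/2+a^{(\ell)}\bm Z\bm x/2)^\top & r+b^{(\ell)}\end{pmatrix}\succeq\bm O\ (\forall\ell\in[L]),\\ & \begin{pmatrix}\bm P&\bm p\\ \bm p^\top&s\end{pmatrix}\succeq\bm O,\quad \bm Z\bm x\in\mathcal X, \end{aligned} $$ with $\bm x,\bm p,\bm q\in\mathbb R^N$, $\bm P,\bm Q\in\mathcal S^N$, $r,s\in\mathbb R$. Equivalently (by strong duality), $f(\bm z)$ is the optimal value of the dual problem $$ \begin{aligned} (\mathrm D_{\bm z})\quad\max_{\bm\omega,\bm B,\bm\beta,\bm\eta,\bm\lambda,\pi}\quad & -\tfrac{\gamma}{2}\bm z^\top(\bm\omega\circ\bm\omega)-\sum_{\ell\in[L]}\eta^{(\ell)}b^{(\ell)}+\pi\\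 \text{s.t.}\quad & \bm\omega\ge\sum_{\ell\in[L]}a^{(\ell)}\bm\beta^{(\ell)}+\pi\bm1,\\ & \sum_{\ell\in[L]}\bm B^{(\ell)}=\kappa_2\hat{\bm\Sigma}-\hat{\bm\mu}\hat{\bm\mu}^\top+\hat{\bm\mu}\Big(\sum_{\ell\in[L]}\bm\beta^{(\ell)}\Big)^\top+\Big(\sum_{\ell\in[L]}\bm\beta^{(\ell)}\Big)\hat{\bm\mu}^\top,\\ & \sum_{\ell\in[L]}\bm\beta^{(\ell)}=\bm\lambda+\hat{\bm\mu},\quad 1-\sum_{\ell\in[L]}\eta^{(\ell)}=0,\\ & \begin{pmatrix}\bm B^{(\ell)}&\bm\beta^{(\ell)}\\(\bm\beta^{(\ell)})^\top&\eta^{(\ell)}\end{pmatrix}\succeq\bm O\ (\forall\ell\in[L]),\quad\begin{pmatrix}\hat{\bm\Sigma}&\bm\lambda\\\bm\lambda^\top&\kappa_1\end{pmatrix}\succeq\bm O, \end{aligned} $$ with $\bm\omega,\bm\lambda\in\mathbb R^N$, $\bm B=(\bm B^{(\ell)})\in\mathbb R^{N\times N\times L}$, $\bm\beta=(\bm\beta^{(\ell)})\in\mathbb R^{N\times L}$, $\bm\eta=(\eta^{(\ell)})\in\mathbb R^L$, $\pi\in\mathbb R$. For $\bm z\in\mathcal Z_N^k$, let $\bm\omega^\star(\bm z)$ be the $\bm\omega$-component of an optimal solution to $(\mathrm D_{\bm z})$ and set $\bm g(\bm z)=-\frac{\gamma}{2}\bm\omega^\star(\bm z)\circ\bm\omega^\star(\bm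 z)$. The cutting-plane algorithm (tolerance $\varepsilon\ge0$). Let $\theta_{\mathrm{LB}}\in\mathbb R$ be a lower bound on $f^\star=\min_{\bm z\in\mathcal Z_N^k}f(\bm z)$. Step 0 (Initialization). Set $\mathcal F_1=\{(\bm z,\theta)\in\mathcal Z_N^k\times\mathbb R:\theta\ge\theta_{\mathrm{LB}}\}$, $t\leftarrow1$, $\mathrm{UB}_0\leftarrow\infty$. Step 1 (Surrogate upper-level problem). Let $(\bm z_t,\theta_t)$ be an optimal solution of: minimize $\theta$ subject to $(\bm z,\theta)\in\mathcal F_t$. Set $\mathrm{LB}_t\leftarrow\theta_t$. Step 2 (Dual lower-level problem). Solve $(\mathrm D_{\bm z_t})$ to obtain $f(\bm z_t)$ and $\bm\omega^\star(\bm z_t)$. If $f(\bm z_t)<\mathrm{UB}_{t-1}$, set $\mathrm{UB}_t\leftarrow f(\bm z_t)$ and $\hat{\bm z}\leftarrow\bm z_t$; otherwise set $\mathrm{UB}_t\leftarrow\mathrm{UB}_{t-1}$. Step 3 (Termination condition). If $\mathrm{UB}_t-\mathrm{LB}_t\le\varepsilon$, terminate and output $\hat{\bm z}$. Step 4 (Cut generation). Compute $\bm g(\bm z_t)$ and set $\mathcal F_{t+1}\leftarrow\mathcal F_t\cap\{(\bm z,\theta)\in\mathcal Z_N^k\times\mathbb R:\theta\ge f(\bm z_t)+\bm g(\bm z_t)^\top(\bm z-\bm z_t)\}$. Set $t\leftarrow t+1$ and return to Step 1. *)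

(* Defs.v *)
From HB Require Import structures.
From mathcomp Require Import all_boot all_order all_algebra.
From mathcomp Require Import boolp classical_sets reals ereal.

Set Implicit Arguments.
Unset Strict Implicit.
Unset Printing Implicit Defensive.

Import Order.TTheory GRing.Theory Num.Theory.

Local Open Scope classical_set_scope.
Local Open Scope ring_scope.

Definition psd (R : realType) n (A : 'M[R]_n) : Prop :=
  A^T = A /\ forall v : 'cV[R]_n, 0 <= (v^T *m A *m v) 0 0.

Definition pd (R : realType) n (A : 'M[R]_n) : Prop :=
  A^T = A /\ forall v : 'cV[R]_n, v != 0 -> 0 < (v^T *m A *m v) 0 0.

Definition dotv (R : realType) n (u v : 'cV[R]_n) : R :=
  \sum_i u i 0 * v i 0.

Definition dotm (R : realType) n (A B : 'M[R]_n) : R :=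
  \sum_i \sum_j A i j * B i j.

Definition hadamard (R : realType) n (u v : 'cV[R]_n) : 'cV[R]_n :=
  map2_mx *%R u v.

(* The symmetric (n+1) x (n+1) matrix with diagonal blocks A, s and
   off-diagonal blocks c, c^T. *)
Definition bordered (R : realType) n (A : 'M[R]_n) (c : 'cV[R]_n) (s : R) :
    'M[R]_(n + 1) :=
  block_mx A c c^T s%:M.

Definition Zset (R : realType) (N k : nat) : set 'cV[R]_N :=
  [set z | (forall n, z n 0 = 0 \/ z n 0 = 1) /\ \sum_n z n 0 = k%:R].

Definition simplex (R : realType) (N : nat) : set 'cV[R]_N :=
  [set x | \sum_n x n 0 = 1 /\ forall n, 0 <= x n 0].

Record data (R : realType) (N L M : nat) := Data {
  gam : R;
  kappa1 : R;
  kappa2 : R;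
  acoef : 'I_L -> R;
  bcoef : 'I_L -> R;
  xi : 'I_M -> 'cV[R]_N
}.

Definition muhat (R : realType) N L M (D : data R N L M) : 'cV[R]_N :=
  M%:R^-1 *: \sum_m xi D m.

Definition Sigmahat (R : realType) N L M (D : data R N L M) : 'M[R]_N :=
  M%:R^-1 *: \sum_m (xi D m - muhat D) *m (xi D m - muhat D)^T.

Record primal_var (R : realType) (N : nat) := PrimalVar {
  px : 'cV[R]_N;
  pP : 'M[R]_N;
  pQ : 'M[R]_N;
  pp : 'cV[R]_N;
  pq : 'cV[R]_N;
  pr : R;
  ps : R
}.

Definition primal_obj (R : realType) N L M (D : data R N L M)
    (v : primal_var R N) : R :=
  (2%:R * gam D)^-1 * dotv (px v) (px v)
  + dotm (kappa2 D *: Sigmahat D - muhat D *m (muhat D)^T) (pQ v)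
  + pr v + dotm (Sigmahat D) (pP v) - 2%:R * dotv (muhat D) (pp v)
  + kappa1 D * ps v.

Definition primal_feasible (R : realType) N L M (D : data R N L M)
    (z : 'cV[R]_N) (v : primal_var R N) : Prop :=
  let Zx := diag_mx z^T *m px v in
  [/\ (pP v)^T = pP v /\ (pQ v)^T = pQ v,
      pp v = - (2%:R^-1 *: pq v) - pQ v *m muhat D,
      forall l, psd (bordered (pQ v)
                       (2%:R^-1 *: pq v + (acoef D l / 2%:R) *: Zx)
                       (pr v + bcoef D l)),
      psd (bordered (pP v) (pp v) (ps v)) &
      simplex Zx].

Definition fval (R : realType) N L M (D : data R N L M) (z : 'cV[R]_N) :
    \bar R :=
  ereal_inf [set (primal_obj D v)%:E | v in primal_feasible D z].

Definition fstar (R : realType) N L M (D : data R N L M) (k : nat) : \bar R :=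
  ereal_inf (fval D @` @Zset R N k).

Record dual_var (R : realType) (N L : nat) := DualVar {
  domega : 'cV[R]_N;
  dB : 'I_L -> 'M[R]_N;
  dbeta : 'I_L -> 'cV[R]_N;
  deta : 'I_L -> R;
  dlambda : 'cV[R]_N;
  dpi : R
}.

Definition dual_obj (R : realType) N L M (D : data R N L M) (z : 'cV[R]_N)
    (w : dual_var R N L) : R :=
  - (gam D / 2%:R) * dotv z (hadamard (domega w) (domega w))
  - \sum_l deta w l * bcoef D l + dpi w.

(* The feasible set of the dual problem does not depend on z. *)
Definition dual_feasible (R : realType) N L M (D : data R N L M)
    (w : dual_var R N L) : Prop :=
  let sbeta := \sum_l dbeta w l in
  [/\ (forall n, (\sum_l acoef D l *: dbeta w l) n 0 + dpi w
                   <= domega w n 0),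
      \sum_l dB w l
        = kappa2 D *: Sigmahat D - muhat D *m (muhat D)^T
          + muhat D *m sbeta^T + sbeta *m (muhat D)^T,
      sbeta = dlambda w + muhat D /\ 1 - \sum_l deta w l = 0,
      forall l, psd (bordered (dB w l) (dbeta w l) (deta w l)) &
      psd (bordered (Sigmahat D) (dlambda w) (kappa1 D))].

Definition dual_optimal (R : realType) N L M (D : data R N L M)
    (z : 'cV[R]_N) (w : dual_var R N L) : Prop :=
  dual_feasible D w /\
  forall w', dual_feasible D w' -> dual_obj D z w' <= dual_obj D z w.

Definition gvec (R : realType) N L M (D : data R N L M) (omega : 'cV[R]_N) :
    'cV[R]_N :=
  - (gam D / 2%:R) *: hadamard omega omega.

(* The state at the beginning of an iteration t: the set F_t, the bound
   UB_{t-1} and the incumbent (None until one has been assigned). *)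
Record state (R : realType) (N : nat) := State {
  feas : set ('cV[R]_N * R);
  ub : \bar R;
  incumbent : option 'cV[R]_N
}.

Definition init_state (R : realType) N (k : nat) (thetaLB : R) : state R N :=
  {| feas := [set zt | @Zset R N k zt.1 /\ thetaLB <= zt.2];
     ub := +oo%E;
     incumbent := None |}.

Definition surrogate_optimal (R : realType) N (F : set ('cV[R]_N * R))
    (z : 'cV[R]_N) (theta : R) : Prop :=
  F (z, theta) /\ forall zt, F zt -> theta <= zt.2.

Definition new_ub (R : realType) N L M (D : data R N L M) (S : state R N)
    (z : 'cV[R]_N) : \bar R :=
  if (fval D z < ub S)%E then fval D z else ub S.

Definition new_incumbent (R : realType) N L M (D : data R N L M)
    (S : state R N) (z : 'cV[R]_N) : option 'cV[R]_N :=
  if (fval D z < ub S)%E then Some z else incumbent S.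

Definition cut (R : realType) N L M (D : data R N L M) (k : nat)
    (z omega : 'cV[R]_N) : set ('cV[R]_N * R) :=
  [set zt | @Zset R N k zt.1 /\
     (fval D z + (dotv (gvec D omega) (zt.1 - z))%:E <= zt.2%:E)%E].

Inductive outcome (R : realType) (N : nat) :=
| Output (zhat : 'cV[R]_N)
| Continue (S : state R N).

(* One pass through Steps 1-4.  It is a relation because neither the optimal
   solution of the surrogate problem nor that of the dual problem need be
   unique; a state with no outcome is one in which some step cannot be carried
   out. *)
Inductive iteration (R : realType) N L M (D : data R N L M) (k : nat)
    (eps : R) (S : state R N) : outcome R N -> Prop :=
| iteration_terminate z theta w zhat of
    surrogate_optimal (feas S) z theta &
    dual_optimal D z w &
    (new_ub D S z - theta%:E <= eps%:E)%E &
    new_incumbent D S z = Some zhat :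
    iteration D k eps S (Output zhat)
| iteration_continue z theta w of
    surrogate_optimal (feas S) z theta &
    dual_optimal D z w &
    ~ (new_ub D S z - theta%:E <= eps%:E)%E :
    iteration D k eps S
      (Continue {| feas := feas S `&` cut D k z (domega w);
                   ub := new_ub D S z;
                   incumbent := new_incumbent D S z |}).

Inductive reachable (R : realType) N L M (D : data R N L M) (k : nat)
    (eps thetaLB : R) : state R N -> Prop :=
| reachable_init : reachable D k eps thetaLB (init_state N k thetaLB)
| reachable_next S S' of
    reachable D k eps thetaLB S & iteration D k eps S (Continue S') :
    reachable D k eps thetaLB S'.

(* No run of the algorithm gets stuck or goes on forever. *)
Definition terminates (R : realType) N L M (D : data R N L M) (k : nat)
    (eps thetaLB : R) : Prop :=
  (forall S, reachable D k eps thetaLB S ->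
     exists o, iteration D k eps S o) /\
  ~ exists run : nat -> state R N,
      run 0%N = init_state N k thetaLB /\
      forall t, iteration D k eps (run t) (Continue (run t.+1)).

Definition outputs (R : realType) N L M (D : data R N L M) (k : nat)
    (eps thetaLB : R) (zhat : 'cV[R]_N) : Prop :=
  exists2 S, reachable D k eps thetaLB S & iteration D k eps S (Output zhat).

Definition eps_optimal (R : realType) N L M (D : data R N L M) (k : nat)
    (eps : R) (z : 'cV[R]_N) : Prop :=
  @Zset R N k z /\ (fstar D k <= fval D z <= fstar D k + eps%:E)%E.

(* Main.v *)
Require Import Defs.
From HB Require Import structures.
From mathcomp Require Import all_boot all_order all_algebra.
From mathcomp Require Import boolp classical_sets reals ereal.
From mathcomp Require Import ring lra.

Set Implicit Arguments.
Unset Strict Implicit.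
Unset Printing Implicit Defensive.

Import Order.TTheory GRing.Theory Num.Theory.

Local Open Scope classical_set_scope.
Local Open Scope ring_scope.

(** The theorem rests on one fact of convex analysis: for every selection z the
    dual problem has a maximiser, and its value is f(z) (strong_duality).  The
    dual feasible set does not depend on z and the dual objective is affine in
    z, so a maximiser for z_t is still feasible for any other selection z, and
    weak duality there says exactly that f(z) lies above the cut generated at
    z_t; strong duality at z_t makes this cut tight at z_t (cut_valid).

    The algorithm is then elementary.  Every surrogate feasible set is the part
    above a lower bound of f, so LB_t <= f*; since the incumbent has value UB_t,
    stopping with UB_t - LB_t <= eps certifies eps-optimality
    (output_eps_optimal).  A selection visited twice has, at its second visit,
    LB_t >= f(z_t) >= UB_t because its own tight cut is present, and the
    algorithm stops; there are finitely many selections, so every run is finite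
    (no_infinite_run).

    Strong duality with attainment is obtained from perturbations.  Let the
    right-hand sides of all semidefinite constraints and of the budget
    constraint sum_n (Zx)_n = 1 vary.  The pairs (perturbation, attainable
    objective value) form a convex relation, and every perturbation becomes
    feasible after scaling, because Q, r, P, s can be taken large and the total
    mass of Zx can be any nonnegative number.  A separation theorem in finite
    dimension (convex_relation_multiplier) then gives a linear functional of
    the perturbation supporting this relation at 0.  Monotonicity in the
    semidefinite directions makes its matrix part positive semidefinite;
    choosing the perturbation that cancels every constraint turns the
    inequality into a lower bound on the Lagrangian over all primal variables
    (multiplier_lagrangian).  The Lagrangian is affine in Q, P, q, r, s, so
    these coefficients vanish, which are the equality constraints of the dual,
    and evaluating it at the x that solves the remaining separable problem
    yields a dual objective no smaller than f(z) (dual_attainment).  The sign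
    constraints on Zx are never perturbed: at indices with z_n = 0 they hold
    with equality, so no tightening of them would be feasible. *)

(** * Supporting functionals of convex relations *)

Section ConvexRelation.
Variable R : realType.

(** The one-dimensional case.  Convexity at 0 forces every slope from a point to
    the left of 0 up to (0, m) below every slope from (0, m) to a point on the
    right, so the supremum of the left slopes separates the two families. *)
Lemma slope_separating (g : R -> R -> Prop) (m : R) :
  (forall a t r t' r', 0 <= a <= 1 -> g t r -> g t' r' ->
     g (a * t + (1 - a) * t') (a * r + (1 - a) * r')) ->
  (exists2 s, 0 < s & exists r, g s r) ->
  (exists2 s, s < 0 & exists r, g s r) ->
  (forall r, g 0 r -> m <= r) ->
  exists c, forall t r, g t r -> m + c * t <= r.
Proof.
move=> gconv [s0 s0_gt0 [r0 g0]] [s1 s1_lt0 [r1 g1]] glow.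
have key s r t r' : s < 0 -> 0 < t -> g s r -> g t r' ->
    (m - r) / (- s) <= (r' - m) / t.
  move=> s_lt0 t_gt0 gs gt.
  have d_gt0 : 0 < t - s by lra.
  have dneq0 : t - s != 0 by rewrite gt_eqF.
  have /glow : g 0 (t / (t - s) * r + (1 - t / (t - s)) * r').
    (* These weights cancel the abscissas s < 0 < t. *)
    have -> : 0 = t / (t - s) * s + (1 - t / (t - s)) * t by field.
    apply: gconv => //; apply/andP; split; first by rewrite divr_ge0 ?ltW.
    by rewrite ler_pdivrMr //; lra.
  have -> : t / (t - s) * r + (1 - t / (t - s)) * r'
            = (t * r - s * r') / (t - s) by field.
  rewrite ler_pdivlMr // => mle.
  rewrite ler_pdivrMr ?oppr_gt0 // mulrAC ler_pdivlMr //; lra.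
pose A := [set x | exists s r, [/\ s < 0, g s r & x = (m - r) / - s]].
have A_sup : has_sup A.
  split; first by exists ((m - r1) / - s1), s1, r1.
  by exists ((r0 - m) / s0) => x [s [r [s_lt0 gs ->]]]; exact: key.
exists (sup A) => t r gt.
have [t_lt0|t_gt0|t0] := ltgtP t 0.
- have : (m - r) / - t <= sup A.
    by apply: sup_upper_bound => //; exists t, r.
  by rewrite ler_pdivrMr ?oppr_gt0 //; lra.
- have : sup A <= (r - m) / t.
    apply: ge_sup; first by case: A_sup.
    by move=> x [s [r' [s_lt0 gs ->]]]; exact: key.
  by rewrite ler_pdivlMr //; lra.
- by move: gt; rewrite t0 mulr0 addr0; exact: glow.
Qed.

(** A convex relation G between perturbations u and values r, read as r is
    attainable under u, has a supporting functional at 0 as soon as every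
    direction can be followed a little.  Working with a relation instead of its
    infimum u |-> inf r avoids having to know that this infimum is finite.  The
    coordinates are treated one at a time: once the slope c along one
    coordinate is fixed, that coordinate is projected out by letting it range
    freely and charging c per unit, which keeps the relation convex and keeps m
    a lower bound at 0. *)
Lemma convex_relation_multiplier (T : finType) (G : (T -> R) -> R -> Prop)
    (m : R) :
  (forall a u r u' r', 0 <= a <= 1 -> G u r -> G u' r' ->
     G (fun i => a * u i + (1 - a) * u' i) (a * r + (1 - a) * r')) ->
  (forall u, exists2 s, 0 < s & exists r, G (fun i => s * u i) r) ->
  (forall r, G (fun=> 0) r -> m <= r) ->
  exists c : T -> R, forall u r, G u r -> m + \sum_i c i * u i <= r.
Proof.
suff gen (s : seq T) : uniq s -> forall G : (T -> R) -> R -> Prop,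
    (forall a u r u' r', 0 <= a <= 1 -> G u r -> G u' r' ->
     G (fun i => a * u i + (1 - a) * u' i) (a * r + (1 - a) * r')) ->
    (forall u, exists2 s, 0 < s & exists r, G (fun i => s * u i) r) ->
    (forall r, G (fun=> 0) r -> m <= r) ->
    exists c : T -> R, forall u r, (forall i, i \notin s -> u i = 0) ->
      G u r -> m + \sum_(i <- s) c i * u i <= r.
  move=> Gconv Gabs Glow.
  have [c cP] := gen (index_enum T) (index_enum_uniq T) G Gconv Gabs Glow.
  by exists c => u r; apply: cP => i; rewrite mem_index_enum.
elim: s => [_|i s IHs /= /andP[is_notin s_uniq]] {}G Gconv Gabs Glow.
  exists (fun=> 0) => u r u0; rewrite big_nil addr0.
  by rewrite (_ : u = fun=> 0) => [/Glow//|]; apply/funext => j; exact: u0.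
pose delta t j : R := if j == i then t else 0.
have [c0 c0P] : exists c, forall t r, G (delta t) r -> m + c * t <= r.
  apply: slope_separating.
  - move=> a t r t' r' a01 Gt Gt'.
    rewrite (_ : delta _ = fun j => a * delta t j + (1 - a) * delta t' j).
      exact: Gconv.
    by apply/funext => j; rewrite /delta; case: ifP; rewrite // !mulr0 addr0.
  - have [t t_gt0 [r Gr]] := Gabs (delta 1); exists t => //; exists r.
    rewrite (_ : delta t = fun j => t * delta 1 j) //.
    by apply/funext => j; rewrite /delta; case: ifP; rewrite ?mulr1 ?mulr0.
  - have [t t_gt0 [r Gr]] := Gabs (delta (-1)); exists (- t); first by lra.
    exists r; rewrite (_ : delta (- t) = fun j => t * delta (-1) j) //.
    by apply/funext => j; rewrite /delta; case: ifP; rewrite ?mulrN1 ?mulr0.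
  - move=> r; rewrite (_ : delta 0 = fun=> 0); first exact: Glow.
    by apply/funext => j; rewrite /delta; case: ifP.
(* The coordinate i is projected out, each unit of it costing c0. *)
pose G1 u r := exists t, G (fun j => u j + delta t j) (r + c0 * t).
have [||| c cP] := IHs s_uniq G1.
- move=> a u r u' r' a01 [t Gt] [t' Gt']; exists (a * t + (1 - a) * t').
  have := Gconv _ _ _ _ _ a01 Gt Gt'.
  congr (G _ _); last by ring.
  by apply/funext => j; rewrite /delta; case: ifP => _; ring.
- move=> u; have [t t_gt0 [r Gr]] := Gabs u; exists t => //; exists r, 0.
  rewrite mulr0 addr0; rewrite (_ : (fun _ => _) = fun j => t * u j) //.
  by apply/funext => j; rewrite /delta if_same addr0.
- move=> r [t]; rewrite (_ : (fun _ => _) = delta t) => [/c0P|]; first by lra.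
  by apply/funext => j; rewrite add0r.
exists (fun j => if j == i then c0 else c j) => u r u0 Gur.
pose u' j := if j == i then 0 else u j.
have Gu' : G1 u' (r - c0 * u i).
  exists (u i); rewrite subrK (_ : (fun _ => _) = u) //.
  by apply/funext => j; rewrite /u' /delta; case: eqP => [->|_]; ring.
have u'0 j : j \notin s -> u' j = 0.
  move=> js; rewrite /u'; case: eqVneq => // ji; apply: u0.
  by rewrite inE negb_or ji js.
have := cP _ _ u'0 Gu'; rewrite big_cons eqxx.
rewrite (eq_big_seq (fun j => (if j == i then c0 else c j) * u j)).
  by lra.
move=> j js; rewrite /u'; case: eqP => // ji.
by rewrite -ji js in is_notin.
Qed.
End ConvexRelation.

(** * Inner products of vectors and matrices *)

Section Bilinear.
Variable R : realType.

Lemma sum_option (I : finType) (F : option I -> R) :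
  \sum_o F o = F None + \sum_i F (Some i).
Proof.
rewrite (bigD1 None) //=; congr (_ + _).
rewrite (reindex_omap Some id) /=; last by case.
by apply: eq_bigl => i; rewrite eqxx.
Qed.

Lemma dotvE n (u v : 'cV[R]_n) : dotv u v = (u^T *m v) 0 0.
Proof. by rewrite mxE; apply: eq_bigr => i _; rewrite mxE. Qed.

Lemma dotmE n (A B : 'M[R]_n) : dotm A B = \tr (A^T *m B).
Proof.
rewrite /mxtrace /dotm exchange_big /=; apply: eq_bigr => i _.
by rewrite mxE; apply: eq_bigr => j _; rewrite mxE.
Qed.

Lemma dotvC n (u v : 'cV[R]_n) : dotv u v = dotv v u.
Proof. by apply: eq_bigr => i _; rewrite mulrC. Qed.

Lemma dotvDr n (u v w : 'cV[R]_n) : dotv u (v + w) = dotv u v + dotv u w.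
Proof. by rewrite !dotvE mulmxDr mxE. Qed.

Lemma dotvZr n a (u v : 'cV[R]_n) : dotv u (a *: v) = a * dotv u v.
Proof. by rewrite !dotvE -scalemxAr mxE. Qed.

Lemma dotvNr n (u v : 'cV[R]_n) : dotv u (- v) = - dotv u v.
Proof. by rewrite !dotvE mulmxN mxE. Qed.

Lemma dotv0r n (u : 'cV[R]_n) : dotv u 0 = 0.
Proof. by rewrite !dotvE mulmx0 mxE. Qed.

Lemma dotvDl n (u v w : 'cV[R]_n) : dotv (u + v) w = dotv u w + dotv v w.
Proof. by rewrite dotvC dotvDr !(dotvC w). Qed.

Lemma dotvZl n a (u v : 'cV[R]_n) : dotv (a *: u) v = a * dotv u v.
Proof. by rewrite dotvC dotvZr (dotvC v). Qed.

Lemma dotvNl n (u v : 'cV[R]_n) : dotv (- u) v = - dotv u v.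
Proof. by rewrite dotvC dotvNr (dotvC v). Qed.

Lemma dotv0l n (u : 'cV[R]_n) : dotv 0 u = 0.
Proof. by rewrite dotvC dotv0r. Qed.

Lemma dotv_suml n (I : finType) (F : I -> 'cV[R]_n) v :
  dotv (\sum_i F i) v = \sum_i dotv (F i) v.
Proof.
rewrite dotvE linear_sum /= mulmx_suml summxE.
by apply: eq_bigr => i _; rewrite dotvE.
Qed.

Lemma dotvv_ge0 n (u : 'cV[R]_n) : 0 <= dotv u u.
Proof. by apply: sumr_ge0 => i _; rewrite -expr2 sqr_ge0. Qed.

Lemma dotvv_eq0 n (u : 'cV[R]_n) : dotv u u = 0 -> u = 0.
Proof.
move=> /eqP; rewrite psumr_eq0 => [/allP u0|i _]; last first.
  by rewrite -expr2 sqr_ge0.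
apply/colP => i; rewrite mxE; apply/eqP.
by have := u0 i (mem_index_enum i); rewrite -expr2 sqrf_eq0.
Qed.

Lemma dotmC n (A B : 'M[R]_n) : dotm A B = dotm B A.
Proof. by apply: eq_bigr => i _; apply: eq_bigr => j _; rewrite mulrC. Qed.

Lemma dotmDr n (A B C : 'M[R]_n) : dotm A (B + C) = dotm A B + dotm A C.
Proof. by rewrite !dotmE mulmxDr mxtraceD. Qed.

Lemma dotmZr n a (A B : 'M[R]_n) : dotm A (a *: B) = a * dotm A B.
Proof. by rewrite !dotmE -scalemxAr mxtraceZ. Qed.

Lemma dotmNr n (A B : 'M[R]_n) : dotm A (- B) = - dotm A B.
Proof. by rewrite -scaleN1r dotmZr mulN1r. Qed.

Lemma dotm0r n (A : 'M[R]_n) : dotm A 0 = 0.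
Proof. by rewrite -(scale0r 0) dotmZr mul0r. Qed.

Lemma dotmDl n (A B C : 'M[R]_n) : dotm (A + B) C = dotm A C + dotm B C.
Proof. by rewrite dotmC dotmDr !(dotmC C). Qed.

Lemma dotmZl n a (A B : 'M[R]_n) : dotm (a *: A) B = a * dotm A B.
Proof. by rewrite dotmC dotmZr (dotmC B). Qed.

Lemma dotmNl n (A B : 'M[R]_n) : dotm (- A) B = - dotm A B.
Proof. by rewrite dotmC dotmNr (dotmC B). Qed.

Lemma dotm0l n (A : 'M[R]_n) : dotm 0 A = 0.
Proof. by rewrite dotmC dotm0r. Qed.

Lemma dotm_suml n (I : finType) (F : I -> 'M[R]_n) B :
  dotm (\sum_i F i) B = \sum_i dotm (F i) B.
Proof.
rewrite dotmE linear_sum /= mulmx_suml linear_sum.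
by apply: eq_bigr => i _; rewrite dotmE.
Qed.

Lemma dotmm_eq0 n (A : 'M[R]_n) : dotm A A = 0 -> A = 0.
Proof.
move=> /eqP; have Age0 i : 0 <= \sum_j A i j * A i j.
  by apply: sumr_ge0 => j _; rewrite -expr2 sqr_ge0.
rewrite psumr_eq0 => [/allP A0|i _]; last exact: Age0.
apply/matrixP => i j; rewrite mxE; apply/eqP.
have := A0 i (mem_index_enum i); rewrite psumr_eq0 => [/allP A0i|k _].
  by have := A0i j (mem_index_enum j); rewrite -expr2 sqrf_eq0.
by rewrite -expr2 sqr_ge0.
Qed.

Lemma dotm_outer n (A : 'M[R]_n) (u v : 'cV[R]_n) :
  dotm A (u *m v^T) = (u^T *m A *m v) 0 0.
Proof.
rewrite dotmE mulmxA mxtrace_mulC mulmxA trace_mx11.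
by rewrite -[LHS]trace_mx11 -mxtrace_tr !trmx_mul !trmxK mulmxA trace_mx11.
Qed.

Lemma dotm_outerl n (A : 'M[R]_n) (u v : 'cV[R]_n) :
  dotm (u *m v^T) A = dotv u (A *m v).
Proof. by rewrite dotmC dotm_outer dotvE mulmxA. Qed.

Lemma dotm_tr n (A B : 'M[R]_n) : dotm A^T B^T = dotm A B.
Proof. by rewrite !dotmE trmxK mxtrace_mulC -mxtrace_tr trmx_mul trmxK. Qed.

Lemma dotm_bordered n (A A' : 'M[R]_n) (c c' : 'cV[R]_n) s s' :
  dotm (bordered A c s) (bordered A' c' s')
  = dotm A A' + 2%:R * dotv c c' + s * s'.
Proof.
rewrite !dotmE /bordered tr_block_mx mulmx_block mxtrace_block !mxtraceD.
rewrite trmxK tr_scalar_mx -scalar_mxM mxtrace_scalar mulr1n dotvE.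
rewrite -(trace_mx11 (c^T *m c')) (mxtrace_mulC c).
by rewrite -[X in _ + X + _]mxtrace_tr trmx_mul trmxK; ring.
Qed.

End Bilinear.

(** * Positive semidefinite matrices *)

Section Psd.
Variable R : realType.

Lemma affine_bounded_below (m k a : R) : (forall t, m <= k + t * a) -> a = 0.
Proof.
move=> bnd; apply: contrapT => /eqP a_neq0.
(* This t takes the affine function to m - 1. *)
have := bnd ((m - k - 1) / a); rewrite divfK //; lra.
Qed.

Lemma psdE n (A : 'M[R]_n) :
  psd A <-> A^T = A /\ forall v, 0 <= dotv v (A *m v).
Proof.
by split=> -[AT Age0]; split=> // v; have := Age0 v; rewrite dotvE mulmxA.
Qed.

Lemma dotv_symm n (A : 'M[R]_n) (u v : 'cV[R]_n) :
  A^T = A -> dotv u (A *m v) = dotv v (A *m u).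
Proof.
by move=> AT; rewrite dotvC !dotvE trmx_mul AT mulmxA.
Qed.

Lemma dotv_delta n (i : 'I_n) (v : 'cV[R]_n) : dotv (delta_mx i 0) v = v i 0.
Proof.
rewrite /dotv (bigD1 i) //= mxE !eqxx mul1r big1 ?addr0 // => j ji.
by rewrite mxE (negbTE ji) mul0r.
Qed.

Lemma mulmx_deltar n (A : 'M[R]_n) (i : 'I_n) :
  A *m (delta_mx i 0 : 'cV_n) = col i A.
Proof. by rewrite colE. Qed.

Lemma psd_diag_ge0 n (A : 'M[R]_n) i : psd A -> 0 <= A i i.
Proof.
by move=> /psdE[_ /(_ (delta_mx i 0))]; rewrite dotv_delta mulmx_deltar mxE.
Qed.

(** Along e_j + t e_i the quadratic form is affine in t when A_ii = 0, and an
    affine function bounded below is constant. *)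
Lemma psd_diag0 n (A : 'M[R]_n) i j : psd A -> A i i = 0 -> A i j = 0.
Proof.
move=> /psdE[AT Age0] Aii0.
have AE k l : A k l = A l k by rewrite -[in LHS]AT mxE.
suff : 2%:R * A i j = 0 by move=> ?; lra.
apply: (@affine_bounded_below 0 (A j j)) => t.
have := Age0 (delta_mx j 0 + t *: delta_mx i 0).
rewrite mulmxDr -scalemxAr dotvDl !dotvDr !dotvZl !dotvZr !dotv_delta.
rewrite !mulmx_deltar !mxE Aii0 (AE j i); lra.
Qed.

(** The quadratic form of the difference at v is that of A at
    v - (e_i^T A v / A_ii) e_i, the point where it is least on the line
    through v in direction e_i. *)
Lemma psd_peel n (A : 'M[R]_n) i : psd A -> 0 < A i i ->
  psd (A - (A i i)^-1 *: (col i A *m (col i A)^T)).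
Proof.
move=> /psdE[AT Age0] Aii_gt0; apply/psdE; split.
  by rewrite linearB linearZ /= trmx_mul trmxK AT.
move=> v; set s := dotv (col i A) v.
have sE : dotv (delta_mx i 0) (A *m v) = s.
  by rewrite dotv_symm // mulmx_deltar dotvC.
have := Age0 (v - (s / A i i) *: delta_mx i 0).
rewrite mulmxBr -scalemxAr dotvDl !dotvDr !dotvNl !dotvNr !dotvZl !dotvZr sE.
rewrite (dotv_symm v (delta_mx i 0)) // sE dotv_delta mulmx_deltar mxE.
rewrite mulmxBl dotvDr dotvNr -scalemxAl dotvZr -mulmxA.
rewrite (_ : (col i A)^T *m v = s%:M); last first.
  by rewrite [LHS]mx11_scalar /s dotvE.
rewrite mul_mx_scalar dotvZr [dotv v (col i A)]dotvC -/s.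
congr (0 <= _); field.
by rewrite gt_eqF.
Qed.

(** Peeling rank-one matrices off A clears its diagonal entries one by one, and
    so writes A as a sum of nonnegative multiples of a a^T, for which the inner
    product with B is the quadratic form of B at a. *)
Lemma psd_dotm_ge0 n (A B : 'M[R]_n) : psd A -> psd B -> 0 <= dotm A B.
Proof.
move=> Apsd /psdE[_ Bge0].
have [k] := ubnP #|[pred i | A i i != 0]|; elim: k => // k IHk in A Apsd *.
rewrite ltnS => lek; have [A0|[i Aii_neq0]] : (forall i, A i i = 0) \/
    exists i, A i i != 0.
- have [/existsP|/existsPn A0] := boolP [exists i, A i i != 0]; first by right.
  by left=> i; apply/eqP; rewrite -[_ == _]negbK.
- rewrite (_ : A = 0) 1?dotmC ?dotm0r //; apply/matrixP => i j.
  by rewrite psd_diag0 // mxE.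
have Aii_gt0 : 0 < A i i by rewrite lt_neqAle eq_sym Aii_neq0 psd_diag_ge0.
have peel := psd_peel Apsd Aii_gt0; set A' := A - _ in peel.
have -> : A = A' + (A i i)^-1 *: (col i A *m (col i A)^T) by rewrite subrK.
rewrite dotmDl dotmZl dotm_outerl addr_ge0 //; last first.
  by rewrite mulr_ge0 ?invr_ge0 // ltW.
apply: IHk peel _; apply: leq_trans lek; apply: proper_card.
apply/properP; split; last first.
  exists i; rewrite !inE // negbK !mxE big_ord1 !mxE.
  by rewrite mulrA mulVf // mul1r subrr.
apply/fintype.subsetP => j; rewrite !inE; apply: contraNN => /eqP Ajj0.
by rewrite !mxE big_ord1 !mxE Ajj0 (psd_diag0 i Apsd Ajj0) mul0r mulr0 subrr.
Qed.

Lemma bordered_sym n (A : 'M[R]_n) c s :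
  A^T = A -> (bordered A c s)^T = bordered A c s.
Proof.
by move=> AT; rewrite /bordered tr_block_mx AT trmxK tr_scalar_mx.
Qed.

Lemma symmetric_bordered n (Y : 'M[R]_(n + 1)) : Y^T = Y ->
  (ulsubmx Y)^T = ulsubmx Y /\
  Y = bordered (ulsubmx Y) (ursubmx Y) (drsubmx Y 0 0).
Proof.
move=> YT; split; first by rewrite trmx_ulsub YT.
by rewrite /bordered trmx_ursub YT -mx11_scalar submxK.
Qed.

Lemma borderedD n (A A' : 'M[R]_n) c c' s s' :
  bordered A c s + bordered A' c' s' = bordered (A + A') (c + c') (s + s').
Proof. by rewrite /bordered add_block_mx linearD raddfD. Qed.

Lemma borderedZ n a (A : 'M[R]_n) c s :
  a *: bordered A c s = bordered (a *: A) (a *: c) (a * s).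
Proof. by rewrite /bordered scale_block_mx linearZ scale_scalar_mx. Qed.

Lemma shift_psd n (U : 'M[R]_n) : exists t, forall t' v, t <= t' ->
  0 <= dotv v ((t'%:M + U) *m v).
Proof.
exists (\sum_i \sum_j `|U i j|) => t v let'.
rewrite mulmxDl mul_scalar_mx dotvDr dotvZr.
apply: (@le_trans _ _ ((\sum_i \sum_j `|U i j|) * dotv v v + dotv v (U *m v))).
  rewrite mulr_suml /dotv -big_split /=; apply: sumr_ge0 => i _.
  rewrite mulr_suml mxE mulr_sumr -big_split /=; apply: sumr_ge0 => j _.
  have vv k : v k 0 * v k 0 <= dotv v v.
    rewrite /dotv (bigD1 k) //= lerDl; apply: sumr_ge0 => l _.
    by rewrite -expr2 sqr_ge0.
  have vij : `|v i 0 * v j 0| <= dotv v v.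
    have := vv i; have := vv j; have := sqr_ge0 (`|v i 0| - `|v j 0|).
    by rewrite sqrrB !real_normK ?num_real // normrM !expr2; lra.
  have : - (U i j * (v i 0 * v j 0)) <= `|U i j| * dotv v v.
    apply: le_trans (ler_norm _) _; rewrite normrN normrM.
    by rewrite ler_wpM2l.
  by rewrite /dotv; lra.
by rewrite lerD2r ler_wpM2r // dotvv_ge0.
Qed.

(** The cone of matrices with nonnegative quadratic form is used without
    symmetry, so it contains every antisymmetric matrix together with its
    opposite; this is what forces Y to be symmetric. *)
Lemma psd_of_dual n (Y : 'M[R]_n) :
  (forall W, (forall v, 0 <= dotv v (W *m v)) -> 0 <= dotm Y W) -> psd Y.
Proof.
move=> Yge0; split; last first.
  move=> v; rewrite -dotm_outer; apply: Yge0 => u.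
  rewrite -mulmxA (_ : v^T *m u = (dotv v u)%:M).
    by rewrite mul_mx_scalar dotvZr (dotvC u) -expr2 sqr_ge0.
  by rewrite [LHS]mx11_scalar dotvE.
have skew0 W : W^T = - W -> dotm Y W = 0.
  move=> WT; have q0 v : dotv v (W *m v) = 0.
    have := dotvC v (W *m v); rewrite [in X in _ = X -> _]dotvE trmx_mul WT.
    by rewrite mulmxN mulNmx [X in _ = X -> _]mxE -mulmxA -dotvE; lra.
  have YW : 0 <= dotm Y W by apply: Yge0 => v; rewrite q0.
  have : 0 <= dotm Y (- W) by apply: Yge0 => v; rewrite mulNmx dotvNr q0 oppr0.
  by rewrite dotmNr; lra.
apply/eqP; rewrite -subr_eq0; apply/eqP; apply: dotmm_eq0.
have dYT : (Y^T - Y)^T = - (Y^T - Y) by rewrite linearB /= trmxK opprB.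
have dY := skew0 _ dYT.
rewrite dotmDl dotmNl -dotm_tr trmxK dYT dotmNr dY; lra.
Qed.

End Psd.

(** * The Lagrangian and weak duality *)

Section Duality.
Variables (R : realType) (N L M : nat) (D : data R N L M).
Implicit Types (z y : 'cV[R]_N) (v : primal_var R N) (w : dual_var R N L).

(** The semidefinite constraints form one family indexed by an option type, so
    that their perturbations and multipliers can be handled uniformly. *)
Definition pblock z v (o : option 'I_L) : 'M[R]_(N + 1) :=
  if o is Some l then
    bordered (pQ v)
      (2%:R^-1 *: pq v + (acoef D l / 2%:R) *: (diag_mx z^T *m px v))
      (pr v + bcoef D l)
  else bordered (pP v) (pp v) (ps v).

Definition linked v := pp v = - (2%:R^-1 *: pq v) - pQ v *m muhat D.

Definition symmetricPQ v := (pP v)^T = pP v /\ (pQ v)^T = pQ v.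

(** With p eliminated, the Lagrangian is affine in each of Q, q, r, P, s, and
    the residuals of the equality constraints of the dual are its coefficients.
    Weak duality uses that they vanish at dual feasible points; attainment in
    the dual uses that they must vanish for the Lagrangian to be bounded
    below. *)
Lemma lagrangian_expansion z v (B : 'I_L -> 'M[R]_N) beta eta S lambda kappa :
  linked v -> symmetricPQ v ->
  let sbeta := \sum_l beta l in
  let mu := muhat D in
  let Y o := if o is Some l then bordered (B l) (beta l) (eta l)
             else bordered S lambda kappa in
  primal_obj D v - \sum_o dotm (Y o) (pblock z v o)
  = (2%:R * gam D)^-1 * dotv (px v) (px v)
    - \sum_l acoef D l * dotv (beta l) (diag_mx z^T *m px v)
    - \sum_l eta l * bcoef D l
    + dotm (kappa2 D *: Sigmahat D - mu *m mu^T + mu *m (lambda + mu)^T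
            + (lambda + mu) *m mu^T - \sum_l B l) (pQ v)
    + dotv (lambda + mu - sbeta) (pq v)
    + (1 - \sum_l eta l) * pr v
    + dotm (Sigmahat D - S) (pP v)
    + (kappa1 D - kappa) * ps v.
Proof.
move=> plink [_ QT] sbeta mu Y; set y := diag_mx _ *m _.
have sumY : \sum_l dotm (Y (Some l)) (pblock z v (Some l)) =
    dotm (\sum_l B l) (pQ v) + dotv sbeta (pq v)
    + \sum_l acoef D l * dotv (beta l) y
    + (\sum_l eta l) * pr v + \sum_l eta l * bcoef D l.
  rewrite dotm_suml dotv_suml mulr_suml -!big_split /=; apply: eq_bigr => l _.
  rewrite dotm_bordered dotvDr !dotvZr -/y; field => //.
rewrite sum_option sumY /= dotm_bordered /primal_obj plink -/mu.
have Qsym u : dotv u (pQ v *m mu) = dotv mu (pQ v *m u) by rewrite dotv_symm.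
rewrite !dotmDl !dotmNl !dotm_outerl !dotvDl !dotvDr !dotvNl !dotvNr !dotvZr.
rewrite mulmxDr !dotvDr (Qsym lambda).
by set g := (_ * gam D)^-1; field.
Qed.


Lemma primal_feasibleE z v :
  primal_feasible D z v <->
  [/\ symmetricPQ v, linked v, forall o, psd (pblock z v o) &
      simplex (diag_mx z^T *m px v)].
Proof.
split=> [[sPQ plink Qpsd Ppsd xs]|[sPQ plink bpsd xs]].
  by split=> // -[l|]; [exact: Qpsd|exact: Ppsd].
by split=> // [l|]; [exact: (bpsd (Some l))|exact: (bpsd None)].
Qed.

Lemma diag_mulE z y n : (diag_mx z^T *m y) n 0 = z n 0 * y n 0.
Proof. by rewrite mul_diag_mx !mxE. Qed.

Lemma sum_acoef (beta : 'I_L -> 'cV[R]_N) y :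
  \sum_l acoef D l * dotv (beta l) y = dotv (\sum_l acoef D l *: beta l) y.
Proof. by rewrite dotv_suml; apply: eq_bigr => l _; rewrite dotvZl. Qed.

Lemma dual_objE z w : dual_obj D z w =
  - (gam D / 2%:R) * (\sum_n z n 0 * domega w n 0 ^+ 2)
  - \sum_l deta w l * bcoef D l + dpi w.
Proof.
rewrite /dual_obj; congr (_ * _ - _ + _).
by apply: eq_bigr => n _; rewrite mxE.
Qed.

(** The semidefinite terms of the Lagrangian are nonnegative, and the rest
    compares coordinatewise: x_n^2 / (2 gamma) - omega_n z_n x_n is at least
    - gamma z_n omega_n^2 / 2 by completing the square. *)
Lemma weak_duality k z v w : 0 < gam D -> Zset k z ->
  primal_feasible D z v -> dual_feasible D w ->
  dual_obj D z w <= primal_obj D v.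
Proof.
move=> gam_gt0 [z01 _] /primal_feasibleE[sPQ plink bpsd [y1 y0]].
move=> [omega_ge sumB [sumbeta sumeta] Ypsd Y0psd].
have := lagrangian_expansion z (dB w) (dbeta w) (deta w)
  (Sigmahat D) (dlambda w) (kappa1 D) plink sPQ.
rewrite /= sumB -sumbeta !subrr sumeta !mul0r dotv0l !dotm0l !addr0.
set S := \sum_o _; have S_ge0 : 0 <= S.
  by apply: sumr_ge0 => -[l|] _; apply: psd_dotm_ge0; rewrite ?bpsd.
set y := diag_mx _ *m _ in y1 y0 *.
move=> objE; rewrite dual_objE; rewrite sum_acoef in objE.
set a_beta : 'cV_N := \sum_l acoef D l *: dbeta w l in omega_ge objE.
suff : 0 <= (2%:R * gam D)^-1 * dotv (px v) (px v)
      - dotv a_beta y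
      + gam D / 2%:R * (\sum_n z n 0 * domega w n 0 ^+ 2)
      - dpi w * \sum_n y n 0.
  by rewrite y1; lra.
rewrite /dotv !mulr_sumr -!(sumrN, big_split) /=; apply: sumr_ge0 => n _.
have yn := diag_mulE z (px v) n; rewrite -/y in yn.
have := y0 n; have := omega_ge n.
set c := a_beta n 0; set om := domega w n 0; set x := px v n 0 in yn *.
move=> com yn0; have : (c + dpi w) * y n 0 <= om * y n 0 by rewrite ler_wpM2r.
suff : 0 <= (2%:R * gam D)^-1 * (x * x) - om * y n 0
            + gam D / 2%:R * (z n 0 * om ^+ 2) by lra.
rewrite yn; case: (z01 n) => ->.
  rewrite !mul0r !mulr0 subr0 addr0 -expr2.
  by rewrite mulr_ge0 ?sqr_ge0 // invr_ge0 mulr_ge0 // ltW.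
rewrite (_ : _ + _ = (2%:R * gam D)^-1 * (x - gam D * om) ^+ 2).
  by rewrite mulr_ge0 ?sqr_ge0 // invr_ge0 mulr_ge0 // ltW.
by field; rewrite gt_eqF.
Qed.

End Duality.

(** * Perturbations of the primal problem *)

Section Perturbation.
Variables (R : realType) (N L M : nat) (D : data R N L M).
Implicit Types (z y : 'cV[R]_N) (v : primal_var R N) (w : dual_var R N L).
Implicit Types (U Y : option 'I_L -> 'M[R]_(N + 1)).

(** The perturbations U o are arbitrary square matrices, so positivity is asked
    of the quadratic form only; for U = 0 the blocks are symmetric anyway.  The
    budget is perturbed by tau while the signs of Zx are kept. *)
Definition perturbed_feasible z U (tau : R) v : Prop :=
  [/\ symmetricPQ v, linked D v,
      forall o u, 0 <= dotv u ((pblock D z v o + U o) *m u),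
      \sum_n (diag_mx z^T *m px v) n 0 = 1 + tau &
      forall n, 0 <= (diag_mx z^T *m px v) n 0].

Lemma pblock_sym z v o : symmetricPQ v -> (pblock D z v o)^T = pblock D z v o.
Proof. by case=> PT QT; case: o => [l|]; rewrite bordered_sym. Qed.

Lemma perturbed_feasible0 z v :
  perturbed_feasible z (fun=> 0) 0 v <-> primal_feasible D z v.
Proof.
rewrite primal_feasibleE.
split=> [[sPQ plink bge0 y1 y0]|[sPQ plink bpsd [y1 y0]]].
  split=> // [o|]; last by split; rewrite ?y1 ?addr0.
  apply/psdE; split; first exact: pblock_sym.
  by move=> u; have := bge0 o u; rewrite addr0.
split=> // [o u|]; last by rewrite addr0.
by rewrite addr0; have /psdE[_] := bpsd o; apply.
Qed.

(** Large multiples of the identity for Q, r and for P, s dominate any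
    perturbation of the blocks, and equal weights on the k selected assets meet
    any nonnegative budget 1 + tau. *)
Lemma perturbed_feasible_exists k z U tau : (0 < k)%N -> Zset k z ->
  -1 <= tau -> exists v, perturbed_feasible z U tau v.
Proof.
move=> k_gt0 [z01 zk] tau_ge.
have k_neq0 : k%:R != 0 :> R by rewrite pnatr_eq0 -lt0n.
pose x : 'cV[R]_N := const_mx ((1 + tau) / k%:R).
(* What remains of the block l once the identity part is split off. *)
pose off l : 'M[R]_(N + 1) :=
  bordered 0 ((acoef D l / 2%:R) *: (diag_mx z^T *m x)) (bcoef D l).
have [tl tlP] := choice (fun l => shift_psd (off l + U (Some l))).
pose t := \sum_l `|tl l|.
have tl_le l : tl l <= t.
  apply: le_trans (ler_norm _) _.
  by rewrite /t (bigD1 l) //= lerDl; apply: sumr_ge0.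
pose p := - (t *: muhat D).
have [t0 t0P] := shift_psd (bordered 0 p 0 + U None).
have scalar_bordered (a : R) : a%:M = bordered a%:M 0 a :> 'M[R]_(N + 1).
  by rewrite /bordered trmx0 scalar_mx_block.
exists (PrimalVar x t0%:M t%:M p 0 t t0); split=> /=.
- by split; rewrite /= tr_scalar_mx.
- by rewrite /linked /= scaler0 oppr0 add0r mul_scalar_mx.
- move=> [l|] u /=.
    have := tlP l t u (tl_le l); rewrite addrA scalar_bordered borderedD.
    by rewrite addr0 add0r scaler0 add0r.
  have := t0P t0 u (lexx _); rewrite addrA scalar_bordered borderedD.
  by rewrite !addr0 add0r.
- transitivity (\sum_n z n 0 * ((1 + tau) / k%:R)).
    by apply: eq_bigr => n _; rewrite diag_mulE mxE.
  by rewrite -mulr_suml zk mulrC divfK.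
- move=> n; rewrite diag_mulE mxE; apply: mulr_ge0.
    by case: (z01 n) => ->.
  by rewrite divr_ge0 //; lra.
Qed.

Definition mix (a : R) v v' := PrimalVar
  (a *: px v + (1 - a) *: px v') (a *: pP v + (1 - a) *: pP v')
  (a *: pQ v + (1 - a) *: pQ v') (a *: pp v + (1 - a) *: pp v')
  (a *: pq v + (1 - a) *: pq v') (a * pr v + (1 - a) * pr v')
  (a * ps v + (1 - a) * ps v').

Lemma pblock_mix z a v v' o :
  pblock D z (mix a v v') o = a *: pblock D z v o + (1 - a) *: pblock D z v' o.
Proof.
case: o => [l|]; rewrite /= !borderedZ borderedD //.
congr bordered; last by ring.
rewrite mulmxDr -!scalemxAr; apply/colP => i; rewrite !mxE; ring.
Qed.

(** The objective is affine except for the quadratic term, whose defect from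
    affinity is a (1 - a) / (2 gamma) times the squared distance between the
    two x components. *)
Lemma primal_obj_mix a v v' : 0 < gam D -> 0 <= a <= 1 ->
  primal_obj D (mix a v v') <= a * primal_obj D v + (1 - a) * primal_obj D v'.
Proof.
move=> gam_gt0 /andP[a_ge0 a_le1].
have xx : dotv (px (mix a v v')) (px (mix a v v')) =
    a * dotv (px v) (px v) + (1 - a) * dotv (px v') (px v')
    - a * (1 - a) * dotv (px v - px v') (px v - px v').
  rewrite /= !(dotvDl, dotvDr, dotvZl, dotvZr, dotvNl, dotvNr).
  rewrite (dotvC (px v')); ring.
have : 0 <= (2%:R * gam D)^-1 *
    (a * (1 - a) * dotv (px v - px v') (px v - px v')).
  rewrite mulr_ge0 ?invr_ge0 ?mulr_ge0 ?dotvv_ge0 ?subr_ge0 //; lra.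
rewrite /primal_obj xx /= !(dotvDr, dotvZr, dotmDr, dotmZr); lra.
Qed.

Lemma perturbed_feasible_mix z a U tau v U' tau' v' : 0 <= a <= 1 ->
  perturbed_feasible z U tau v -> perturbed_feasible z U' tau' v' ->
  perturbed_feasible z (fun o => a *: U o + (1 - a) *: U' o)
    (a * tau + (1 - a) * tau') (mix a v v').
Proof.
move=> /andP[a_ge0 a_le1] [[PT QT] plink bge0 y1 y0].
move=> [[PT' QT'] plink' bge0' y1' y0'].
split.
- by split; rewrite /= linearD !linearZ /= ?PT ?PT' ?QT ?QT'.
- rewrite /linked /= plink plink' mulmxDl -!scalemxAl.
  apply/colP => i; rewrite !mxE; ring.
- move=> o u; rewrite pblock_mix addrACA -!scalerDr mulmxDl -!scalemxAl.
  by rewrite dotvDr !dotvZr addr_ge0 // mulr_ge0 ?subr_ge0.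
- rewrite (eq_bigr (fun n => a * (diag_mx z^T *m px v) n 0 +
      (1 - a) * (diag_mx z^T *m px v') n 0)).
    by rewrite big_split /= -!mulr_sumr y1 y1'; ring.
  by move=> n _; rewrite !diag_mulE !mxE; ring.
- move=> n; rewrite diag_mulE !mxE; have := y0 n; have := y0' n.
  rewrite !diag_mulE => ge' ge.
  rewrite (_ : _ * _ = a * (z n 0 * px v n 0) + (1 - a) * (z n 0 * px v' n 0)).
    by rewrite addr_ge0 // mulr_ge0 ?subr_ge0.
  by ring.
Qed.

(** Obtained by viewing a perturbation as one function on the index set of all
    matrix entries together with the budget, and splitting the supporting
    functional accordingly. *)
Lemma multipliers k z m : 0 < gam D -> (0 < k)%N -> Zset k z ->
  (forall v, primal_feasible D z v -> m <= primal_obj D v) ->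
  exists Y pi, forall U tau v, perturbed_feasible z U tau v ->
    m <= primal_obj D v + \sum_o dotm (Y o) (U o) - pi * tau.
Proof.
move=> gam_gt0 k_gt0 zZ mle.
pose T : finType := option (option 'I_L * ('I_(N + 1) * 'I_(N + 1)))%type.
pose Uof (u : T -> R) o : 'M[R]_(N + 1) := \matrix_(i, j) u (Some (o, (i, j))).
pose G (u : T -> R) r :=
  exists v, perturbed_feasible z (Uof u) (u None) v /\ primal_obj D v <= r.
have [||| c cP] := @convex_relation_multiplier R T G m.
- move=> a u r u' r' a01 [v [vfeas vr]] [v' [v'feas v'r]].
  exists (mix a v v'); split.
    have := perturbed_feasible_mix a01 vfeas v'feas.
    congr (perturbed_feasible _ _ _ _); apply/funext => o.
    by apply/matrixP => i j; rewrite !mxE.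
  apply: le_trans (primal_obj_mix _ _ gam_gt0 a01) _.
  by case/andP: a01 => *; rewrite lerD // ler_wpM2l ?subr_ge0.
(* This scaling keeps the budget 1 + s * u None nonnegative. *)
- move=> u; pose s := (1 + `|u None|)^-1.
  have s_gt0 : 0 < s by rewrite invr_gt0 ltr_wpDr.
  exists s => //.
  have [|v vfeas] := @perturbed_feasible_exists k z
    (Uof (fun i => s * u i)) (s * u None) k_gt0 zZ; last first.
    by exists (primal_obj D v), v.
  rewrite lerNl -mulrN mulrC ler_pdivrMr ?mul1r ?ltr_wpDr //.
  by have := ler_norm (- u None); rewrite normrN; lra.
- move=> r [v [vfeas]]; apply: le_trans; apply: mle.
  apply/perturbed_feasible0; congr (perturbed_feasible _ _ _ _): vfeas.
  by apply/funext => o; apply/matrixP => i j; rewrite !mxE.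
exists (fun o => - \matrix_(i, j) c (Some (o, (i, j)))), (c None).
move=> U tau v vfeas.
pose u t := if t is Some (o, (i, j)) then U o i j else tau.
have /cP : G u (primal_obj D v).
  exists v; split=> //; congr (perturbed_feasible _ _ _ _): vfeas.
  by apply/funext => o; apply/matrixP => i j; rewrite !mxE.
have -> : \sum_t c t * u t = c None * tau
    + \sum_o dotm (\matrix_(i, j) c (Some (o, (i, j)))) (U o).
  rewrite [LHS]sum_option /=; congr (_ + _).
  rewrite (eq_bigr (fun p => c (Some (p.1, p.2)) * U p.1 p.2.1 p.2.2)) =>
    [|[o [i j]] //].
  rewrite -(pair_bigA _ (fun o q => c (Some (o, q)) * U o q.1 q.2)) /=.
  apply: eq_bigr => o _.
  rewrite (eq_bigr (fun p => c (Some (o, (p.1, p.2))) * U o p.1 p.2)) =>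
    [|[i j] //].
  rewrite -(pair_bigA _ (fun i j => c (Some (o, (i, j))) * U o i j)) /=.
  by apply: eq_bigr => i _; apply: eq_bigr => j _; rewrite mxE.
rewrite (eq_bigr _ (fun o _ => dotmNl _ _)) sumrN; lra.
Qed.

End Perturbation.

(** * Attainment in the dual problem *)

Section DualAttainment.
Variables (R : realType) (N L M : nat) (D : data R N L M).
Implicit Types (z y : 'cV[R]_N) (v : primal_var R N) (w : dual_var R N L).
Implicit Types (U Y : option 'I_L -> 'M[R]_(N + 1)).

Lemma affine_bounded_below_ge0 (m k a : R) :
  (forall t, 0 <= t -> m <= k + t * a) -> 0 <= a.
Proof.
move=> bnd; have [//|a_lt0] := leP 0 a.
(* At this t the affine function is at most m - 1. *)
have t_ge0 : 0 <= (`|m - k| + 1) / - a.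
  by rewrite divr_ge0 ?oppr_ge0 ?ltW // ltr_wpDl.
have := bnd _ t_ge0.
rewrite (_ : _ / _ * a = - (`|m - k| + 1)); last by field; rewrite lt_eqF.
by have := ler_norm (k - m); rewrite distrC; lra.
Qed.

Definition linked_var x (P Q : 'M[R]_N) q r s :=
  PrimalVar x P Q (- (2%:R^-1 *: q) - Q *m muhat D) q r s.

(** Adding a matrix with nonnegative quadratic form to the perturbation of a
    block keeps a point feasible, and this can be done any number of times
    without violating the bound only if the multiplier pairs nonnegatively with
    that matrix. *)
Lemma multiplier_psd z m Y pi :
  (forall U tau v, perturbed_feasible D z U tau v ->
    m <= primal_obj D v + \sum_o dotm (Y o) (U o) - pi * tau) ->
  forall o, psd (Y o).
Proof.
move=> YP o; apply: psd_of_dual => W Wge0.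
pose v := linked_var 0 0 0 0 0 0.
apply: (@affine_bounded_below_ge0 m
  (primal_obj D v - \sum_o dotm (Y o) (pblock D z v o) + pi)) => t t_ge0.
pose U o' := - pblock D z v o' + (if o' == o then t *: W else 0).
have /YP : perturbed_feasible D z U (-1) v.
  split.
  - by split; rewrite trmx0.
  - by [].
  - move=> o' u; rewrite addNKr; case: ifP => _; last by rewrite mul0mx dotv0r.
    by rewrite -scalemxAl dotvZr mulr_ge0.
  - by rewrite mulmx0 big1 ?subrr // => n _; rewrite mxE.
  - by move=> n; rewrite mulmx0 mxE.
rewrite (eq_bigr (fun o' => - dotm (Y o') (pblock D z v o') +
    dotm (Y o') (if o' == o then t *: W else 0))); last first.
  by move=> o' _; rewrite dotmDr dotmNr.
have W_only : \sum_o' dotm (Y o') (if o' == o then t *: W else 0)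
    = t * dotm (Y o) W.
  rewrite (bigD1 o) //= eqxx dotmZr big1 ?addr0 // => o' /negbTE ->.
  by rewrite dotm0r.
by rewrite big_split sumrN /= W_only; lra.
Qed.

(** Any primal point with the right signs becomes feasible under the
    perturbation that cancels its own blocks and budget defect. *)
Lemma multiplier_lagrangian z m Y pi :
  (forall U tau v, perturbed_feasible D z U tau v ->
    m <= primal_obj D v + \sum_o dotm (Y o) (U o) - pi * tau) ->
  forall v, symmetricPQ v -> linked D v ->
    (forall n, 0 <= (diag_mx z^T *m px v) n 0) ->
    m <= primal_obj D v - \sum_o dotm (Y o) (pblock D z v o)
         - pi * (\sum_n (diag_mx z^T *m px v) n 0 - 1).
Proof.
move=> YP v sPQ plink y0.
have /YP : perturbed_feasible D z (fun o => - pblock D z v o)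
    (\sum_n (diag_mx z^T *m px v) n 0 - 1) v.
  split=> // [o u|]; first by rewrite subrr mul0mx dotv0r.
  by rewrite addrC subrK.
by rewrite (eq_bigr _ (fun o _ => dotmNr _ _)) sumrN.
Qed.

(** Vanishing coefficients of the Lagrangian are the equality constraints of
    the dual, with the multipliers as dual variables.  What is left is to
    minimise x^T x / (2 gamma) - (c + pi 1)^T Zx over Zx >= 0, where c is the
    sum of the a_l beta_l; it is solved by x_n = gamma z_n omega_n with
    omega_n = max(0, c_n + pi), which also satisfies the dual inequality
    constraint. *)
Lemma dual_attainment k z m : 0 < gam D -> (0 < k)%N -> Zset k z ->
  (Sigmahat D)^T = Sigmahat D ->
  (forall v, primal_feasible D z v -> m <= primal_obj D v) ->
  exists2 w, dual_feasible D w & m <= dual_obj D z w.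
Proof.
move=> gam_gt0 k_gt0 zZ ST mle.
have [Y [pi YP]] := multipliers gam_gt0 k_gt0 zZ mle.
have Ypsd := multiplier_psd YP.
have Ylag := multiplier_lagrangian YP.
have Ysym o : (Y o)^T = Y o by case: (Ypsd o).
pose B l := ulsubmx (Y (Some l)); pose beta l := ursubmx (Y (Some l)).
pose eta l : R := drsubmx (Y (Some l)) 0 0.
pose S := ulsubmx (Y None); pose lambda := ursubmx (Y None).
pose kappa : R := drsubmx (Y None) 0 0.
have YE o : Y o = if o is Some l then bordered (B l) (beta l) (eta l)
                  else bordered S lambda kappa.
  by case: o => [l|]; exact: proj2 (symmetric_bordered (Ysym _)).
have BT l : (B l)^T = B l by exact: proj1 (symmetric_bordered (Ysym (Some l))).
have S_T : S^T = S by exact: proj1 (symmetric_bordered (Ysym None)).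
pose RQ := kappa2 D *: Sigmahat D - muhat D *m (muhat D)^T
  + muhat D *m (lambda + muhat D)^T + (lambda + muhat D) *m (muhat D)^T
  - \sum_l B l.
pose e := lambda + muhat D - \sum_l beta l.
have bound x (P Q : 'M[R]_N) q r s : P^T = P -> Q^T = Q ->
    (forall n, 0 <= (diag_mx z^T *m x) n 0) ->
    m <= (2%:R * gam D)^-1 * dotv x x
      - \sum_l acoef D l * dotv (beta l) (diag_mx z^T *m x)
      - \sum_l eta l * bcoef D l + dotm RQ Q + dotv e q
      + (1 - \sum_l eta l) * r + dotm (Sigmahat D - S) P
      + (kappa1 D - kappa) * s - pi * (\sum_n (diag_mx z^T *m x) n 0 - 1).
  move=> PT QT y0.
  have := Ylag (linked_var x P Q q r s) (conj PT QT) erefl y0.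
  rewrite (eq_bigr _ (fun o _ => congr1 (fun A => dotm A _) (YE o))).
  by rewrite lagrangian_expansion.
have bound0 (P Q : 'M[R]_N) q r s : P^T = P -> Q^T = Q ->
    m <= pi - \sum_l eta l * bcoef D l + (dotm RQ Q + dotv e q
      + (1 - \sum_l eta l) * r + dotm (Sigmahat D - S) P
      + (kappa1 D - kappa) * s).
  move=> PT QT; have := bound 0 P Q q r s PT QT.
  have sum0 : \sum_n (0 : 'cV[R]_N) n 0 = 0 by apply: big1 => n _; rewrite mxE.
  have suma0 : \sum_l acoef D l * dotv (beta l) 0 = 0.
    by apply: big1 => l _; rewrite dotv0r mulr0.
  have z0 (n : 'I_N) : 0 <= (0 : 'cV[R]_N) n 0 by rewrite mxE.
  by rewrite mulmx0 sum0 suma0 dotv0r => /(_ z0); lra.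
have etaE : 1 - \sum_l eta l = 0.
  apply: affine_bounded_below => t.
  have := bound0 0 0 0 t 0 (trmx0 _ _ _) (trmx0 _ _ _).
  by rewrite !dotm0r dotv0r mulr0 !addr0 !add0r mulrC; exact.
have kappaE : kappa1 D - kappa = 0.
  apply: affine_bounded_below => t.
  have := bound0 0 0 0 0 t (trmx0 _ _ _) (trmx0 _ _ _).
  by rewrite !dotm0r dotv0r mulr0 !addr0 !add0r mulrC; exact.
have eE : e = 0.
  apply: dotvv_eq0; apply: affine_bounded_below => t.
  have := bound0 0 0 (t *: e) 0 0 (trmx0 _ _ _) (trmx0 _ _ _).
  by rewrite !dotm0r dotvZr !mulr0 !addr0 !add0r; exact.
have SE : Sigmahat D - S = 0.
  apply: dotmm_eq0; apply: affine_bounded_below => t.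
  have := bound0 (t *: (Sigmahat D - S)) 0 0 0 0.
  rewrite !dotm0r dotv0r dotmZr !mulr0 !addr0 !add0r; apply; last exact: trmx0.
  by rewrite linearZ linearB /= ST S_T.
have RQE : RQ = 0.
  apply: dotmm_eq0; apply: affine_bounded_below => t.
  have := bound0 0 (t *: RQ) 0 0 0.
  rewrite !dotm0r dotv0r dotmZr !mulr0 !addr0; apply; first exact: trmx0.
  rewrite linearZ /=; congr (_ *: _).
  rewrite /RQ linearB /= linearD /= linearD /= linearB /= linearZ /= ST.
  rewrite !trmx_mul !trmxK raddf_sum /= (eq_bigr _ (fun l _ => BT l)).
  by congr (_ - _); rewrite addrAC.
pose c := \sum_l acoef D l *: beta l.
pose omega : 'cV[R]_N := \col_n Num.max 0 (c n 0 + pi).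
have sumbeta : \sum_l beta l = lambda + muhat D.
  by apply/esym/eqP; rewrite -subr_eq0 -/e eE.
exists (DualVar omega B beta eta lambda pi).
  split=> //=.
  - by move=> n; rewrite mxE le_max lexx orbT.
  - by apply/esym/eqP; rewrite -subr_eq0 sumbeta -/RQ RQE.
  - by move=> l; rewrite -(YE (Some l)).
  - move: SE kappaE => /subr0_eq -> /subr0_eq ->.
    by rewrite -(YE None).
pose x : 'cV[R]_N := \col_n (gam D * z n 0 * omega n 0).
have omega_ge0 n : 0 <= omega n 0 by rewrite mxE le_max lexx.
have zx n : (diag_mx z^T *m x) n 0 = gam D * z n 0 * omega n 0.
  by rewrite diag_mulE mxE; case: zZ => /(_ n)[] -> _; ring.
have := bound x 0 0 0 0 0 (trmx0 _ _ _) (trmx0 _ _ _).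
rewrite !dotm0r dotv0r !mulr0 !addr0 sum_acoef -/c dual_objE /= .
have zx_ge0 n : 0 <= (diag_mx z^T *m x) n 0.
  by rewrite zx !mulr_ge0 ?(ltW gam_gt0) //; case: zZ => /(_ n)[] -> _.
move=> /(_ zx_ge0)/le_trans; apply.
suff : (2%:R * gam D)^-1 * dotv x x - dotv c (diag_mx z^T *m x)
    - pi * \sum_n (diag_mx z^T *m x) n 0
    + gam D / 2%:R * \sum_n z n 0 * omega n 0 ^+ 2 = 0 by lra.
rewrite /dotv !mulr_sumr -!(sumrN, big_split) /=; apply: big1 => n _.
rewrite zx [x n 0]mxE.
have cw : (c n 0 + pi) * omega n 0 = omega n 0 ^+ 2.
  rewrite (_ : omega n 0 = Num.max 0 (c n 0 + pi)); last by rewrite mxE.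
  by rewrite expr2; case: leP => // _; rewrite !mulr0.
case: zZ => /(_ n)[] -> _; first by ring.
rewrite !mulr1 mul1r -cw.
rewrite (_ : gam D * omega n 0 * (gam D * omega n 0)
  = gam D ^+ 2 * ((c n 0 + pi) * omega n 0)); last by rewrite cw; ring.
by field; rewrite gt_eqF.
Qed.
End DualAttainment.

(** * Strong duality *)

Section DualFeasible.
Variable R : realType.

Lemma psdD n (A B : 'M[R]_n) : psd A -> psd B -> psd (A + B).
Proof.
move=> /psdE[AT Age0] /psdE[BT Bge0]; apply/psdE; split.
  by rewrite linearD /= AT BT.
by move=> v; rewrite mulmxDl dotvDr addr_ge0.
Qed.

Lemma psdZ n a (A : 'M[R]_n) : 0 <= a -> psd A -> psd (a *: A).
Proof.
move=> a_ge0 /psdE[AT Age0]; apply/psdE; split; first by rewrite linearZ /= AT.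
by move=> v; rewrite -scalemxAl dotvZr mulr_ge0.
Qed.

Lemma psd_outer n (u : 'cV[R]_n) : psd (u *m u^T).
Proof.
apply/psdE; split; first by rewrite trmx_mul trmxK.
move=> v; rewrite -mulmxA [u^T *m v]mx11_scalar -dotvE mul_mx_scalar dotvZr.
by rewrite (dotvC v) -expr2 sqr_ge0.
Qed.

Lemma psd_bordered_diag n (A : 'M[R]_n) s : psd A -> 0 <= s ->
  psd (bordered A 0 s).
Proof.
move=> /psdE[AT Age0] s_ge0; apply/psdE; split; first exact: bordered_sym.
move=> v; rewrite -[v]vsubmxK /bordered mul_block_col trmx0 !mul0mx addr0 add0r.
rewrite mul_scalar_mx /dotv big_split_ord /= addr_ge0 //.
  rewrite (eq_bigr (fun i => usubmx v i 0 * (A *m usubmx v) i 0)) => [|i _].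
    exact: Age0.
  by rewrite !col_mxEu.
rewrite (eq_bigr (fun i => s * (dsubmx v i 0) ^+ 2)) => [|i _].
  by apply: sumr_ge0 => i _; rewrite mulr_ge0 // sqr_ge0.
by rewrite !col_mxEd [X in _ * X]mxE mulrCA.
Qed.

Lemma bordered_outer n (u : 'cV[R]_n) :
  bordered (u *m u^T) u 1 = col_mx u 1%:M *m (col_mx u 1%:M)^T.
Proof. by rewrite tr_col_mx mul_col_row trmx1 !mulmx1 mul1mx. Qed.

Lemma psd_of_pd n (A : 'M[R]_n) : pd A -> psd A.
Proof.
case=> AT Agt0; split=> // v; have [->|/Agt0/ltW//] := eqVneq v 0.
by rewrite mulmx0 mxE.
Qed.

(** With lambda = 0, each of the L pieces can receive the share 1/L of the
    mass, of the mean mu and of the second moment kappa_2 Sigma + mu mu^T.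
    This point bounds the primal problem from below. *)
Lemma dual_feasible_exists N L M (D : data R N L M) : (0 < L)%N ->
  psd (Sigmahat D) -> 0 <= kappa1 D -> 0 <= kappa2 D ->
  exists w, dual_feasible D w.
Proof.
move=> L_gt0 Spsd k1 k2; set mu := muhat D.
have L_neq0 : L%:R != 0 :> R by rewrite pnatr_eq0 -lt0n.
have sumL (V : lmodType R) (x : V) : \sum_(l < L) L%:R^-1 *: x = x.
  by rewrite sumr_const card_ord -scaler_nat scalerA divff // scale1r.
pose beta := L%:R^-1 *: mu.
pose B := L%:R^-1 *: (kappa2 D *: Sigmahat D + mu *m mu^T).
exists (DualVar (\sum_(l < L) acoef D l *: beta) (fun=> B) (fun=> beta)
  (fun=> L%:R^-1) 0 0); split=> /=.
- by move=> n; rewrite addr0.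
- by rewrite !sumL -/mu subrK.
- rewrite sumL add0r sumr_const card_ord -[_ *+ L]mulr_natl divff //.
  by rewrite subrr.
- move=> l; rewrite (_ : bordered _ _ _ = L%:R^-1 *:
      (kappa2 D *: bordered (Sigmahat D) 0 0 + bordered (mu *m mu^T) mu 1)).
    apply: psdZ; first by rewrite invr_ge0.
    apply: psdD; first by apply: psdZ => //; exact: psd_bordered_diag.
    by rewrite bordered_outer; exact: psd_outer.
  by rewrite borderedZ borderedD borderedZ scaler0 mulr0 !add0r mulr1.
- exact: psd_bordered_diag.
Qed.
End DualFeasible.

Section StrongDuality.
Variables (R : realType) (N L M k : nat) (D : data R N L M).
Hypotheses (L_gt0 : (0 < L)%N) (k_gt0 : (0 < k)%N).
Hypotheses (gam_gt0 : 0 < gam D) (kappa1_ge0 : 0 <= kappa1 D).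
Hypotheses (kappa2_ge0 : 0 <= kappa2 D) (Spsd : psd (Sigmahat D)).

Lemma fval_weak_duality z w : Zset k z -> dual_feasible D w ->
  ((dual_obj D z w)%:E <= fval D z)%E.
Proof.
move=> zZ wfeas; apply: le_ereal_inf_tmp => _ [v vfeas <-].
by rewrite lee_fin (weak_duality gam_gt0 zZ).
Qed.

(** f(z) is real, bounded above by a primal feasible value and below by a dual
    feasible one, so it can serve as the lower bound m in dual_attainment; the
    dual point found there is optimal by weak duality. *)
Lemma strong_duality z : Zset k z ->
  exists2 w, dual_optimal D z w & fval D z = (dual_obj D z w)%:E.
Proof.
move=> zZ.
have [w0 w0feas] := dual_feasible_exists L_gt0 Spsd kappa1_ge0 kappa2_ge0.
have [v0 /perturbed_feasible0 v0feas] :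
    exists v, perturbed_feasible D z (fun=> 0) 0 v.
  by apply: perturbed_feasible_exists k_gt0 zZ _; lra.
have lb := fval_weak_duality zZ w0feas.
have ub v : primal_feasible D z v -> (fval D z <= (primal_obj D v)%:E)%E.
  by move=> vfeas; apply: ereal_inf_lbound; exists v.
have fvalE : fval D z = (fine (fval D z))%:E.
  rewrite fineK // fin_numE; apply/andP; split; apply/eqP => fE.
    by move: lb; rewrite fE.
  by have := ub _ v0feas; rewrite fE.
have [w wfeas wge] : exists2 w, dual_feasible D w &
    fine (fval D z) <= dual_obj D z w.
  apply: dual_attainment gam_gt0 k_gt0 zZ _ _; first by case: Spsd.
  by move=> v /ub; rewrite fvalE lee_fin.
have weq : fval D z = (dual_obj D z w)%:E.
  by apply/eqP; rewrite eq_le fval_weak_duality // andbT fvalE lee_fin.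
exists w => //; split=> // w' w'feas.
by rewrite -lee_fin -weq fval_weak_duality.
Qed.

Lemma dual_optimal_fval z w : Zset k z -> dual_optimal D z w ->
  fval D z = (dual_obj D z w)%:E.
Proof.
move=> zZ [wfeas wopt]; have [w' [w'feas w'opt] ->] := strong_duality zZ.
by congr EFin; apply/eqP; rewrite eq_le wopt // w'opt.
Qed.

(** The dual objective is affine in z with gradient g, so the value of the
    cut at z' is the dual objective there, of a point that is still feasible. *)
Lemma cut_valid z z' w : Zset k z -> Zset k z' -> dual_optimal D z w ->
  (fval D z + (dotv (gvec D (domega w)) (z' - z))%:E <= fval D z')%E.
Proof.
move=> zZ z'Z wopt; rewrite (dual_optimal_fval zZ wopt) -EFinD.
rewrite (_ : _ + _ = dual_obj D z' w).
  by apply: fval_weak_duality; case: wopt.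
rewrite /dual_obj /gvec dotvZl dotvDr dotvNr ![dotv (hadamard _ _) _]dotvC.
by ring.
Qed.
End StrongDuality.

(** * The cutting-plane algorithm *)

Section CuttingPlane.
Variables (R : realType) (N L M k : nat) (D : data R N L M) (eps thetaLB : R).
Hypotheses (L_gt0 : (0 < L)%N) (k_gt0 : (0 < k)%N) (k_leN : (k <= N)%N).
Hypotheses (gam_gt0 : 0 < gam D) (kappa1_ge0 : 0 <= kappa1 D).
Hypotheses (kappa2_ge0 : 0 <= kappa2 D) (Spsd : psd (Sigmahat D)).
Hypotheses (eps_ge0 : 0 <= eps) (thetaLB_le : (thetaLB%:E <= fstar D k)%E).

Definition indicator (A : {set 'I_N}) : 'cV[R]_N := \col_n (n \in A)%:R.

Lemma Zset_indicator z :
  Zset k z <->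
  exists A : {set 'I_N}, #|A| = k /\ z = indicator A.
Proof.
have sum_indicator (A : {set 'I_N}) : \sum_n indicator A n 0 = #|A|%:R.
  rewrite -sum1_card natr_sum [RHS]big_mkcond /=; apply: eq_bigr => n _.
  by rewrite mxE; case: (n \in A).
split=> [[z01 zk]|[A [Ak ->]]]; last first.
  split; last by rewrite sum_indicator Ak.
  by move=> n; rewrite mxE; case: (n \in A); [right|left].
pose A := finset (fun n => z n 0 == 1).
have zA : z = indicator A.
  apply/colP => n; rewrite mxE inE; case: (z01 n) => ->; last by rewrite eqxx.
  by rewrite eq_sym oner_eq0.
exists A; split=> //; apply/eqP; rewrite -(eqr_nat R) -sum_indicator -zA zk.
by rewrite eqxx.
Qed.


Lemma fval_fine z : Zset k z -> fval D z = (fine (fval D z))%:E.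
Proof.
move=> zZ; have [w _ ->//] :=
  strong_duality L_gt0 k_gt0 gam_gt0 kappa1_ge0 kappa2_ge0 Spsd zZ.
Qed.

(** The surrogate feasible set is the region above a function lb that minorises
    f; this keeps the surrogate problem solvable and its optimum below f*. *)
Definition invariant (S : state R N) : Prop :=
  (exists2 lb : 'cV[R]_N -> R,
     forall z, Zset k z -> ((lb z)%:E <= fval D z)%E &
     feas S = [set zt | Zset k zt.1 /\ lb zt.1 <= zt.2]) /\
  (if incumbent S is Some z then Zset k z /\ ub S = fval D z
   else ub S = +oo%E).

(** An incumbent exists as soon as one f(z) has been computed: f(z) is finite,
    so the first iteration improves on the infinite initial upper bound. *)
Lemma new_incumbent_spec S z : invariant S -> Zset k z ->
  exists2 zhat, new_incumbent D S z = Some zhat &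
    Zset k zhat /\ new_ub D S z = fval D zhat.
Proof.
move=> [_ inc] zZ; rewrite /new_incumbent /new_ub.
case: ifPn => [_|]; first by exists z.
case: (incumbent S) inc => [zhat [? ?] _|ub_oo]; first by exists zhat.
by rewrite ub_oo (fval_fine zZ) ltry.
Qed.

Lemma invariant_init : invariant (init_state N k thetaLB).
Proof.
split=> //; exists (fun=> thetaLB) => // z zZ.
by apply: le_trans thetaLB_le _; apply: ereal_inf_lbound; exists z.
Qed.

Lemma iteration_continueP S S' : iteration D k eps S (Continue S') ->
  exists z theta w, [/\ surrogate_optimal (feas S) z theta, dual_optimal D z w,
    ~ (new_ub D S z - theta%:E <= eps%:E)%E &
    S' = {| feas := feas S `&` cut D k z (domega w);
            ub := new_ub D S z;
            incumbent := new_incumbent D S z |}].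
Proof.
by move=> it; inversion_clear it as [|z theta w]; exists z, theta, w.
Qed.

Lemma surrogate_Zset S z theta : invariant S ->
  surrogate_optimal (feas S) z theta -> Zset k z.
Proof. by move=> [[lb _ ->] _] [[]]. Qed.

Lemma surrogate_lower_bound S z theta z' : invariant S ->
  surrogate_optimal (feas S) z theta -> Zset k z' ->
  (theta%:E <= fval D z')%E.
Proof.
move=> [[lb lble ->] _] [_ opt] z'Z; rewrite fval_fine // lee_fin.
apply: (opt (z', _)); split=> //=.
by rewrite -lee_fin -fval_fine // lble.
Qed.

Lemma invariant_next S S' :
  invariant S -> iteration D k eps S (Continue S') -> invariant S'.
Proof.
move=> Sinv /iteration_continueP[z [theta [w [sopt wopt _ ->]]]].
have zZ := surrogate_Zset Sinv sopt.
split=> /=; last by have [zhat -> []] := new_incumbent_spec Sinv zZ.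
case: Sinv => [[lb lble ->] _].
exists (fun z' => Num.max (lb z')
  (fine (fval D z) + dotv (gvec D (domega w)) (z' - z))).
  move=> z' z'Z; rewrite EFin_max ge_max lble //= EFinD -fval_fine //.
  exact: (cut_valid L_gt0 k_gt0 gam_gt0 kappa1_ge0 kappa2_ge0 Spsd zZ z'Z wopt).
apply/seteqP; split=> -[z' th] /=; rewrite ge_max.
  by case=> -[z'Z ->] [_]; rewrite fval_fine // -EFinD lee_fin.
case=> z'Z /andP[lbth cutth]; split=> //; split=> //=.
by rewrite fval_fine // -EFinD lee_fin.
Qed.

Lemma reachable_invariant S : reachable D k eps thetaLB S -> invariant S.
Proof.
elim=> [|{}S S' _ Sinv it]; first exact: invariant_init.
exact: invariant_next it.
Qed.

(** For each of the finitely many selections the best theta is lb z, so a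
    selection minimising lb is optimal. *)
Lemma surrogate_optimal_exists S : invariant S ->
  exists z theta, surrogate_optimal (feas S) z theta.
Proof.
move=> [[lb _ ->] _].
pose A0 : {set 'I_N} := finset (fun i : 'I_N => (i < k)%N).
have A0k : #|A0| == k.
  rewrite -sum1_card (eq_bigl (fun i : 'I_N => (i < k)%N)); last first.
    by move=> i; rewrite inE.
  by rewrite (big_ord_narrow k_leN) /= sum1_card card_ord.
case: (@arg_minP _ R _ A0 (fun A : {set 'I_N} => #|A| == k)
  (fun A => lb (indicator A)) A0k) => A /eqP Ak Amin.
exists (indicator A), (lb (indicator A)); split=> /=.
  by split=> //; apply/Zset_indicator; exists A.
move=> [z th] /= [/Zset_indicator[B [Bk ->]]]; apply: le_trans.
by apply: Amin; rewrite Bk.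
Qed.

Lemma iteration_exists S : invariant S -> exists o, iteration D k eps S o.
Proof.
move=> Sinv; have [z [theta sopt]] := surrogate_optimal_exists Sinv.
have zZ := surrogate_Zset Sinv sopt.
have [w wopt _] :=
  strong_duality L_gt0 k_gt0 gam_gt0 kappa1_ge0 kappa2_ge0 Spsd zZ.
have [zhat zhatE _] := new_incumbent_spec Sinv zZ.
have [stop|/negP go] := boolP (new_ub D S z - theta%:E <= eps%:E)%E.
  by exists (Output zhat); exact: iteration_terminate sopt wopt stop zhatE.
by eexists; exact: iteration_continue sopt wopt go.
Qed.

Lemma new_ub_le S z : (new_ub D S z <= fval D z)%E /\ (new_ub D S z <= ub S)%E.
Proof. by rewrite /new_ub; case: ltP => // /ltW. Qed.

(** By the pigeonhole principle a run of more steps than there are sets of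
    assets visits some selection twice, and its second visit meets the stopping
    test because its own cut is tight. *)
Lemma no_infinite_run (run : nat -> state R N) :
  run 0%N = init_state N k thetaLB ->
  ~ forall t, iteration D k eps (run t) (Continue (run t.+1)).
Proof.
move=> run0 runS.
have inv t : invariant (run t).
  elim: t => [|t IHt]; first by rewrite run0; exact: invariant_init.
  exact: invariant_next (runS t).
have [z_ zP] := choice (fun t => iteration_continueP (runS t)).
have [theta_ {}zP] := choice zP; have [w_ {}zP] := choice zP.
have zZ t : Zset k (z_ t) by case: (zP t) => /(surrogate_Zset (inv t)).
have [A_ AP] := choice (fun t => (Zset_indicator (z_ t)).1 (zZ t)).
have zA t : z_ t = indicator (A_ t) by case: (AP t).
have past i j : (i < j)%N -> feas (run j) `<=` cut D k (z_ i) (domega (w_ i))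
    /\ (ub (run j) <= fval D (z_ i))%E.
  elim: j => // j IHj; case: (zP j) => _ _ _ -> /=.
  rewrite ltnS leq_eqVlt => /predU1P[->|/IHj[feas_cut ub_le]].
    by split; [exact: subIsetr|exact: (new_ub_le _ _).1].
  split; first by move=> zt [/feas_cut].
  exact: le_trans (new_ub_le _ _).2 ub_le.
have revisit i j : (i < j)%N -> z_ i <> z_ j.
  move=> ij zij; have [feas_cut ub_le] := past i j ij.
  case: (zP j) => -[/feas_cut[_ /=]] + _ _ [].
  rewrite zij subrr dotv0r adde0 => fval_le.
  apply: (@le_trans _ _ 0%E); last by rewrite lee_fin.
  rewrite EFinN leeBlDr // add0e; apply: le_trans fval_le.
  exact: (new_ub_le _ _).1.
(* One more step than there are sets of assets. *)
pose f (i : 'I_(#|{: {set 'I_N}}|).+1) := A_ i.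
have /injectivePn[i [j ij fij]] : ~~ injectiveb f.
  apply/negP => /injectiveP /leq_card; by rewrite card_ord ltnn.
have zij : z_ i = z_ j by rewrite !zA; congr indicator.
move: ij; rewrite -val_eqE /= neq_ltn => /orP[] /revisit; apply => //.
Qed.

Lemma output_eps_optimal zhat :
  outputs D k eps thetaLB zhat -> eps_optimal D k eps zhat.
Proof.
move=> [S /reachable_invariant Sinv it].
inversion_clear it as [z theta w ? sopt _ stop zhatE|].
have zZ := surrogate_Zset Sinv sopt.
have [zhat' + [zhatZ ubE]] := new_incumbent_spec Sinv zZ.
rewrite zhatE => -[zhat_eq]; rewrite -{}zhat_eq in zhatZ ubE.
split=> //; apply/andP; split; first by apply: ereal_inf_lbound; exists zhat.
move: stop; rewrite ubE leeBlDr // addeC => /le_trans; apply.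
rewrite leeD2r //; apply: le_ereal_inf_tmp => _ [z' z'Z <-].
exact: surrogate_lower_bound sopt z'Z.
Qed.
End CuttingPlane.

Theorem theorem3 (R : realType) (N L M k : nat) (D : data R N L M)
    (eps thetaLB : R)
    (N_ge1 : (1 <= N)%N) (L_ge1 : (1 <= L)%N) (M_ge1 : (1 <= M)%N)
    (k_range : (1 <= k <= N)%N)
    (gam_gt0 : 0 < gam D) (kappa1_gt0 : 0 < kappa1 D)
    (kappa2_ge1 : 1 <= kappa2 D)
    (Sigmahat_pd : pd (Sigmahat D))
    (eps_ge0 : 0 <= eps)
    (thetaLB_le : (thetaLB%:E <= fstar D k)%E) :
  terminates D k eps thetaLB /\
  (forall zhat, outputs D k eps thetaLB zhat -> eps_optimal D k eps zhat).
Proof.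
have /andP[k_gt0 k_leN] := k_range.
have kappa1_ge0 := ltW kappa1_gt0.
have kappa2_ge0 : 0 <= kappa2 D by exact: le_trans ler01 kappa2_ge1.
have Spsd := psd_of_pd Sigmahat_pd.
split; last by move=> zhat; exact: output_eps_optimal.
split; last by case=> run [run0 runS]; exact: no_infinite_run run0 runS.
move=> S Sreach; apply: iteration_exists => //.
exact: reachable_invariant Sreach.
Qed.
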